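(* Let $d\ge1$ be fixed, $N=n^d$, and let $P_N^{\mathrm{jit}}$ be the jittered sample of $N$ points in $[0,1]^d$. Then $$ h_\infty(P_N^{\mathrm{jit}})\asymp_d N^{-1/d}, \qquad \rho_\infty(P_N^{\mathrm{jit}})=\Theta_{\mathbb P}\left(N^{1/(d+1)}\right) $$ as $n\to\infty$, where $\asymp_d$ means two-sided bounds with positive constants depending only on $d$.
   Context: Jittered sampling: for $n\ge1$ and $N=n^d$, divide $[0,1]^d$ into the $N$ cubes $Q_{\boldsymbol i}=\prod_{j=1}^d[\frac{i_j}{n},\frac{i_j+1}{n})$, $\boldsymbol i\in\{0,\dots,n-1\}^d$. In each $Q_{\boldsymbol i}$ place one point $\boldsymbol X_{\boldsymbol i}$, independently over $\boldsymbol i$ and uniformly distributed in $Q_{\boldsymbol i}$; put $P_N^{\mathrm{jit}}=(\boldsymbol X_{\boldsymbol i})_{\boldsymbol i}$. For an $N$-point multiset $P=(\boldsymbol x_n)_{0\le n<N}$ in $[0,1]^d$: the covering radius is $h_\infty(P)=\sup_{\boldsymbol z\in[0,1]^d}\min_{0\le n<N}\|\boldsymbol z-\boldsymbol x_n\|_\infty$; for $N\ge2$ the separation radius is $q_\infty(P)=\frac12\min_{n<n'}\|\boldsymbol x_n-\boldsymbol x_{n'}\|_\infty$; the mesh ratio is $\rho_\infty(P)=h_\infty(P)/q_\infty(P)$, with $\rho_\infty(P)=\infty$ if $q_\infty(P)=0$. Probabilistic order: for random variables $X_n$ and positive deterministic $a_n$, $X_n=O_{\mathbb P}(a_n)$ means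 that for every $\varepsilon>0$ there are $C_\varepsilon>0$ and $n_\varepsilon$ with $\mathbb P(|X_n|>C_\varepsilon a_n)\le\varepsilon$ for all $n\ge n_\varepsilon$. For positive random variables, $X_n=\Omega_{\mathbb P}(a_n)$ means $a_n/X_n=O_{\mathbb P}(1)$, and $X_n=\Theta_{\mathbb P}(a_n)$ means both. *)

(* Defs.v *)
From HB Require Import structures.
From mathcomp Require Export all_boot all_order all_algebra.
From mathcomp Require Export all_classical all_reals all_analysis.

Set Implicit Arguments.
Unset Strict Implicit.
Unset Printing Implicit Defensive.

Import Order.TTheory GRing.Theory Num.Theory.
Import numFieldNormedType.Exports.

Local Open Scope classical_set_scope.
Local Open Scope ring_scope.

(* Points of R^d are d-tuples, whose sigma-algebra in the library is the one
   generated by the coordinates, i.e. the Borel sigma-algebra of R^d. *)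

Section Geometry.
Context {R : realType} {d : nat}.

Definition dist_sup (x y : d.-tuple R) : R :=
  \big[Num.max/0]_(j < d) `|tnth x j - tnth y j|.

Definition unit_cube : set (d.-tuple R) :=
  [set x | forall j, 0 <= tnth x j <= 1].

Definition grid_cube (n : nat) (i : d.-tuple 'I_n) : set (d.-tuple R) :=
  [set x | forall j,
     (tnth i j)%:R / n%:R <= tnth x j < (tnth i j).+1%:R / n%:R].

(* A finite multiset of points is a family indexed by a finite type I.  The
   radii are extended reals: +oo is the minimum over the empty set, so that
   the separation radius of a single point is +oo. *)
Definition covering_radius (I : finType) (x : I -> d.-tuple R) : \bar R :=
  ereal_sup [set \big[Order.min/+oo%E]_(i : I) (dist_sup z (x i))%:E
            | z in unit_cube].

Definition separation_radius (I : finType) (x : I -> d.-tuple R) : \bar R :=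
  ((2^-1)%:E * \big[Order.min/+oo]_(p : I * I | p.1 != p.2)
                 (dist_sup (x p.1) (x p.2))%:E)%E.

Definition mesh_ratio (I : finType) (x : I -> d.-tuple R) : \bar R :=
  (if separation_radius x == 0 then +oo
   else covering_radius x / separation_radius x)%E.

End Geometry.

(* Lebesgue measure on R^d: R^0 is a single point of mass 1, and R^(d+1) is
   identified with R * R^d. *)
Fixpoint lebesgue_tuple (R : realType) (d : nat) : set (d.-tuple R) -> \bar R :=
  match d with
  | 0 => fun A => \d_([tuple] : 0.-tuple R) A
  | d'.+1 =>
    pushforward (@lebesgue_measure R \x @lebesgue_tuple R d')%E
      (fun p : R * d'.-tuple R => [the d'.+1.-tuple R of p.1 :: p.2])
  end.

Section Probability.
Context {R : realType} {disp : measure_display} {T : measurableType disp}.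
Variable P : probability T R.

Definition uniform_on (d : nat) (X : {RV P >-> d.-tuple R})
    (Q : set (d.-tuple R)) : Prop :=
  forall A : set (d.-tuple R), measurable A ->
    distribution P X A = (lebesgue_tuple (A `&` Q) / lebesgue_tuple Q)%E.

Definition mutually_independent (disp' : measure_display)
    (T' : measurableType disp') (I : finType) (X : I -> {RV P >-> T'}) : Prop :=
  forall (J : {set I}) (A : I -> set T'), (forall i, measurable (A i)) ->
    P (\bigcap_(i in [set` J]) (X i @^-1` A i)) =
    (\prod_(i in J) P (X i @^-1` A i))%E.

Definition jittered_sample (d n : nat)
    (X : d.-tuple 'I_n -> {RV P >-> d.-tuple R}) : Prop :=
  [/\ forall i w, grid_cube i (X i w),
      mutually_independent X
    & forall i, uniform_on (X i) (grid_cube i)].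

End Probability.

(* The n-th random variable lives on its own probability space.  Values are
   extended reals, with a / +oo = 0. *)
Section ProbabilisticOrder.
Context {R : realType} {disp : nat -> measure_display}
  {T : forall n, measurableType (disp n)}.
Variable P : forall n, probability (T n) R.

Definition bigO_P (X : forall n, T n -> \bar R) (a : nat -> R) : Prop :=
  forall eps : R, 0 < eps -> exists (C : R) (n0 : nat), 0 < C /\
    forall n, (n0 <= n)%N ->
      (P n [set w | (C * a n)%:E < `|X n w|] <= eps%:E)%E.

Definition bigOmega_P (X : forall n, T n -> \bar R) (a : nat -> R) : Prop :=
  bigO_P (fun n w => ((a n)%:E / X n w)%E) (fun=> 1).

Definition bigTheta_P (X : forall n, T n -> \bar R) (a : nat -> R) : Prop :=
  bigO_P X a /\ bigOmega_P X a.

End ProbabilisticOrder.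

(* Main.v *)
Require Import Defs.
From mathcomp Require Import measurable_realfun ring lra zify.

(** The covering radius is of exact order [1/n] for every outcome.  Each point
    of the unit cube shares the closure of a grid cube with a sample point, so
    it is at most [1/n] away from the sample.  Conversely the sample point of
    the corner cube cannot be near both the corner and the centre of that
    cube, and no other sample point comes near either ([covering_radius_le],
    [covering_radius_ge]).  The mesh ratio is therefore governed by the
    separation radius, which has to be shown of order [1 / (n a)] in
    probability, with [a = n ^ (d / (d + 1))], that is [a ^ (d + 1) = n ^ d].

    All probabilities are reduced to counting by cutting every grid cube into
    [m ^ d] fine cells of side [1 / (n m)]: a sample point falls into each fine
    cell of its cube with probability [m ^ - d] ([prob_fine_cell]).

    No pair is too close.  Two sample points at distance below [1 / (n m)] lie
    in adjacent fine cells of different grid cubes.  The two fine cells must be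
    separated by a hyperplane of the coarse grid, so that in one coordinate only
    about [n] pairs of indices are possible instead of about [n m]; this leaves
    [O (n ^ d * m ^ (d - 1))] pairs of cells, each hit with probability
    [m ^ - 2d].  The union bound gives [O ((a / m) ^ (d + 1))]
    ([prob_close_pair]), which is small for [m] a large multiple of [a].

    Some pair is close.  Grid cubes are matched along the first coordinate into
    about [n ^ d / 2] disjoint pairs with a common face.  In each pair, the two
    points lie in facing fine cells on either side of it with probability
    [m ^ - (d + 1)], and the pairs are independent, so all of them fail with
    probability [(1 - m ^ - (d + 1)) ^ (n ^ d / 2)] ([prob_no_close_pair]).
    This is small for [m] a small multiple of [a].

    Including an event in a union bounds its probability only once the event is
    known to be measurable.  For the events about the mesh ratio this comes
    from the measurability of both radii, the covering radius being a supremum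
    over rational centres ([measurable_covering_radius]). *)

Set Implicit Arguments.
Unset Strict Implicit.
Unset Printing Implicit Defensive.

Import Order.TTheory GRing.Theory Num.Theory.
Import numFieldNormedType.Exports.

Local Open Scope classical_set_scope.
Local Open Scope ring_scope.

(** * The sup distance *)

Section Distance.
Context {R : realType} {d : nat}.
Implicit Types x y z : d.-tuple R.

Lemma coord_le_dist_sup x y j : `|tnth x j - tnth y j| <= dist_sup x y.
Proof. exact: (le_bigmax_cond _ (fun j => `|tnth x j - tnth y j|)). Qed.

Lemma dist_sup_le x y (r : R) : 0 <= r ->
  (forall j, `|tnth x j - tnth y j| <= r) -> dist_sup x y <= r.
Proof. by move=> r0 xyr; apply: bigmax_le. Qed.

Lemma dist_sup_ge0 x y : 0 <= dist_sup x y.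
Proof. exact: bigmax_ge_id. Qed.

Lemma dist_sup_triangle y x z : dist_sup x z <= dist_sup x y + dist_sup y z.
Proof.
apply: dist_sup_le => [|j]; first by rewrite addr_ge0 ?dist_sup_ge0.
by rewrite (le_trans (ler_distD (tnth y j) _ _)) ?lerD ?coord_le_dist_sup.
Qed.

Lemma measurable_dist_sup (disp : measure_display) (T : measurableType disp)
    (f g : T -> d.-tuple R) :
  measurable_fun setT f -> measurable_fun setT g ->
  measurable_fun setT (fun w => dist_sup (f w) (g w)).
Proof.
move=> mf mg; rewrite /dist_sup.
elim: (index_enum _) => [|j r IH].
  by under eq_fun do rewrite big_nil; exact: measurable_cst.
under eq_fun do rewrite big_cons.
apply: measurable_maxr => //.
apply: measurableT_comp; first exact: normr_measurable.
apply: measurable_funB.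
  exact: (measurableT_comp (measurable_tnth j) mf).
exact: (measurableT_comp (measurable_tnth j) mg).
Qed.

End Distance.

(** * The covering radius of one point per grid cube *)

Section CoveringRadius.
Context {R : realType} {d n : nat}.
Variable x : d.-tuple 'I_n -> d.-tuple R.
Hypothesis n_gt0 : (0 < n)%N.
Hypothesis x_cube : forall i, grid_cube i (x i).

Lemma grid_cell (z : R) : 0 <= z <= 1 ->
  exists k : 'I_n, k%:R / n%:R <= z <= k.+1%:R / n%:R.
Proof.
move=> /andP[z0 z1].
have n0 : 0 < n%:R :> R by rewrite ltr0n.
(* The right end point 1 belongs to no half-open cell; it closes the last. *)
have [zlt|zge] := ltP z 1.
  have zn0 : 0 <= z * n%:R by rewrite mulr_ge0.
  have [t1 t2] := andP (truncn_itv zn0).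
  have kn : (Num.truncn (z * n%:R)%R < n)%N.
    by rewrite truncn_lt_nat // gtr_pMl.
  exists (Ordinal kn) => /=.
  by rewrite ler_pdivrMr// t1 ler_pdivlMr// ltW.
have kn : (n.-1 < n)%N by rewrite prednK.
exists (Ordinal kn) => /=; rewrite prednK// divff ?gt_eqF// z1 andbT.
by rewrite (le_trans _ zge)// ler_pdivrMr// mul1r ler_nat leq_pred.
Qed.

Lemma covering_radius_le : (covering_radius x <= (n%:R^-1)%:E)%E.
Proof.
apply: ge_ereal_sup => _ [z zc <-].
have /choice[k kP] : forall j, exists k : 'I_n,
    k%:R / n%:R <= tnth z j <= k.+1%:R / n%:R by move=> j; apply: grid_cell.
apply: le_trans (bigmin_le _ [tuple k j | j < d] _) _.
rewrite lee_fin; apply: dist_sup_le => [|j]; first by rewrite invr_ge0.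
have := x_cube [tuple k j | j < d] j; rewrite tnth_mktuple.
have := kP j; rewrite -natr1 mulrDl mul1r ler_distl => /andP[? ?] /andP[? ?].
by apply/andP; split; lra.
Qed.

Hypothesis d_gt0 : (0 < d)%N.

(** If the corner cube's point is at least [1/(4n)] away from the origin, then
    the origin is a hole of that size; otherwise the centre of the corner cube
    is one.  All other points keep a distance of at least [1/(2n)] from both. *)
Lemma covering_radius_ge : (((4 * n%:R)^-1)%:E <= covering_radius x)%E.
Proof.
have n1 : 1 <= n%:R :> R by rewrite ler1n.
pose v : R := n%:R^-1.
have v0 : 0 < v by rewrite invr_gt0 ltr0n.
have v1 : v <= 1 by rewrite invf_le1 ?ltr0n.
have -> : (4 * n%:R)^-1 = v / 4 :> R by rewrite invfM mulrC.
pose i0 : d.-tuple 'I_n := [tuple Ordinal n_gt0 | _ < d].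
pose c (t : R) : d.-tuple R := [tuple t | _ < d].
(* Outside the corner cube every point has a coordinate at least 1/n. *)
have far t i : t <= v / 2 -> i != i0 -> v / 4 <= dist_sup (c t) (x i).
  move=> t1 ne.
  have [j ij] : exists j, (0 < tnth i j)%N.
    apply/existsP; apply: contraNT ne => /existsPn ne.
    apply/eqP/eq_from_tnth => j; apply/val_inj; rewrite tnth_mktuple /=.
    by have := ne j; rewrite lt0n negbK => /eqP.
  apply: le_trans (coord_le_dist_sup _ _ j); rewrite tnth_mktuple.
  have /andP[xj _] := x_cube i j.
  have : v <= tnth (x i) j.
    by apply: le_trans xj; rewrite ler_peMl ?ler1n// ltW.
  by rewrite distrC => ?; apply: le_trans (ler_norm _); lra.
have reach t : 0 <= t -> t <= v / 2 -> v / 4 <= dist_sup (c t) (x i0) ->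
    ((v / 4)%:E <= covering_radius x)%E.
  move=> t0 t1 h0; apply: le_trans (ereal_sup_ubound _); last first.
    by exists (c t) => // j; rewrite tnth_mktuple t0/=; lra.
  apply: le_bigmin => [|i _]; first exact: leey.
  by rewrite lee_fin; have [->//|/far] := eqVneq i i0; apply.
have [near0|] := leP (v / 4) (dist_sup (c 0) (x i0)).
  by apply: (reach 0) => //; rewrite divr_ge0// ltW.
move=> near0; apply: (reach (v / 2)) => //; first by rewrite divr_ge0// ltW.
pose j := Ordinal d_gt0.
have := le_lt_trans (coord_le_dist_sup _ _ j) near0.
rewrite tnth_mktuple sub0r normrN ltr_norml => /andP[_ xj].
apply: le_trans (coord_le_dist_sup _ _ j); rewrite tnth_mktuple.
by apply: le_trans (ler_norm _); lra.
Qed.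

End CoveringRadius.


(** * Measurability of the radii *)

Section Measurability.
Context {R : realType} {d : nat} {I : finType} {disp : measure_display}.
Context {T : measurableType disp} (X : I -> T -> d.-tuple R).
Hypothesis mX : forall i, measurable_fun setT (X i).

Lemma measurable_bigmine (J : Type) (r : seq J) (D : pred J)
    (f : J -> T -> \bar R) :
  (forall j, measurable_fun setT (f j)) ->
  measurable_fun setT
    (fun w => \big[Order.min/+oo%E]_(j <- r | D j) f j w).
Proof.
move=> mf; elim: r => [|j r IH].
  by under eq_fun do rewrite big_nil; exact: measurable_cst.
under eq_fun do rewrite big_cons.
by case: (D j) => //; exact: measurable_mine.
Qed.

Lemma measurable_separation_radius :
  measurable_fun setT (fun w => separation_radius (fun i => X i w)).
Proof.
apply: emeasurable_funM; first exact: measurable_cst.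
apply: (@measurable_bigmine _ _ (fun p : I * I => p.1 != p.2)) => p.
by apply/measurable_EFinP; exact: measurable_dist_sup.
Qed.

Lemma rat_near_unit_interval (z e : R) : 0 <= z <= 1 -> 0 < e ->
  exists q : rat, (0 <= (ratr q : R) <= 1) /\ `|ratr q - z| <= e.
Proof.
move=> /andP[z0 z1] e0.
have : Num.max 0 (z - e) < Num.min 1 (z + e).
  by rewrite lt_min !gt_max; apply/andP; split; apply/andP; split; lra.
move=> /rat_in_itvoo[q]; rewrite in_itv/= lt_min !gt_max.
move=> /andP[/andP[q0 q1] /andP[q2 q3]]; exists q; split; first by lra.
by rewrite ler_distl; apply/andP; split; lra.
Qed.

(** The supremum runs over uncountably many centres; as the distance is
    1-Lipschitz in the centre, the countably many rational ones suffice. *)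
Lemma measurable_covering_radius :
  measurable_fun setT (fun w => covering_radius (fun i => X i w)).
Proof.
pose g (z : d.-tuple R) w := \big[Order.min/+oo%E]_i (dist_sup z (X i w))%:E.
have mg z : measurable_fun setT (g z).
  apply: measurable_bigmine => i; apply/measurable_EFinP.
  by apply: measurable_dist_sup.
(* An enumeration of the rational points of the unit cube, padded with the
   origin where the code is no point of the cube. *)
pose c (k : nat) : d.-tuple R :=
  if @unpickle (d.-tuple rat) k is Some q then
    if [forall j, 0 <= (ratr (tnth q j) : R) <= 1]
    then [tuple ratr (tnth q j) | j < d] else [tuple 0 | _ < d]
  else [tuple 0 | _ < d].
have c_cube k : unit_cube (c k).
  move=> j; rewrite /c; case: unpickle => [q|]; last first.
    by rewrite tnth_mktuple lexx ler01.
  case: forallP => [cq|_]; rewrite tnth_mktuple; first exact: cq.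
  by rewrite lexx ler01.
rewrite (_ : (fun w => _) = fun w => esups (fun k => g (c k) w) 0); last first.
  apply/funext => w; apply/eqP; rewrite eq_le; apply/andP; split.
    apply: ge_ereal_sup => _ [z zc <-]; apply/lee_addgt0Pr => e e0.
    have /choice[q qP] j := rat_near_unit_interval (zc j) e0.
    pose Q : d.-tuple rat := [tuple q j | j < d].
    have cQ : c (pickle Q) = [tuple ratr (q j) | j < d].
      rewrite /c pickleK; case: forallP => [_|[]]; last first.
        by move=> j; rewrite tnth_mktuple; case: (qP j).
      by apply: eq_from_tnth => j; rewrite !tnth_mktuple.
    have : (g z w <= g (c (pickle Q)) w + e%:E)%E.
      rewrite /g -leeBlDr//; apply: le_bigmin => [|i _]; first exact: leey.
      rewrite leeBlDr//; apply: le_trans (bigmin_le _ i _) _.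
      rewrite -EFinD lee_fin addrC.
      apply: le_trans (dist_sup_triangle (c (pickle Q)) _ _) _; rewrite lerD2r.
      apply: dist_sup_le => [|j]; first exact: ltW.
      by rewrite cQ tnth_mktuple distrC; case: (qP j).
    move=> /le_trans; apply; rewrite leeD2r//.
    by apply: ereal_sup_ubound; exists (pickle Q).
  apply: ge_ereal_sup => _ [k _ <-]; apply: ereal_sup_ubound.
  by exists (c k).
exact: measurable_fun_esups.
Qed.

End Measurability.

(** * The separation radius and the mesh ratio *)

Section SeparationRadius.
Context {R : realType} {d : nat} {I : finType}.
Variable x : I -> d.-tuple R.

Lemma separation_radius_ge (r : R) :
  (forall i i', i != i' -> r <= dist_sup (x i) (x i')) ->
  ((r / 2)%:E <= separation_radius x)%E.
Proof.
move=> rx; rewrite mulrC EFinM; apply: lee_wpmul2l; first by rewrite lee_fin.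
by apply: le_bigmin => [|[i i'] /= /rx]; [exact: leey|rewrite lee_fin].
Qed.

Lemma separation_radius_le i i' : i != i' ->
  (separation_radius x <= (dist_sup (x i) (x i') / 2)%:E)%E.
Proof.
move=> ii'; rewrite mulrC EFinM; apply: lee_wpmul2l; first by rewrite lee_fin.
exact: (bigmin_inf (i, i')).
Qed.

Lemma separation_radius_ge0 : (0 <= separation_radius x)%E.
Proof.
have := @separation_radius_ge 0; rewrite mul0r; apply=> i i' _.
exact: dist_sup_ge0.
Qed.

Lemma separation_radius_fin (i i' : I) : i != i' ->
  separation_radius x \is a fin_num.
Proof.
move=> /separation_radius_le h; rewrite ge0_fin_numE ?separation_radius_ge0//.
exact: le_lt_trans h (ltry _).
Qed.

Hypothesis sep_fin : separation_radius x \is a fin_num.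
Hypothesis cov_fin : covering_radius x \is a fin_num.
Hypothesis cov_gt0 : (0 < covering_radius x)%E.

(** Clearing denominators, so that measurability of the two radii is all that
    the events about their quotient require. *)
Lemma lt_mesh_ratio (c : R) : 0 <= c ->
  (c%:E < `|mesh_ratio x|)%E =
  (c%:E * separation_radius x < covering_radius x)%E.
Proof.
move=> c0; rewrite /mesh_ratio.
case: (separation_radius x) sep_fin separation_radius_ge0 => [s| |]// _.
case: (covering_radius x) cov_fin cov_gt0 => [h| |]// _.
rewrite lte_fin lee_fin => h0 s0; rewrite eqe.
have [->|sn0] := eqVneq s 0; first by rewrite mule0 lte_fin h0 ltry.
have {sn0} s0' : 0 < s by rewrite lt_neqAle eq_sym sn0.
rewrite inver gt_eqF// -!EFinM abse_EFin !lte_fin ger0_norm.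
  by rewrite ltr_pdivlMr.
by rewrite divr_ge0// ltW.
Qed.

Lemma lt_div_mesh_ratio (a c : R) : 0 <= a -> 0 <= c ->
  (c%:E < `|a%:E / mesh_ratio x|)%E =
  (c%:E * covering_radius x < a%:E * separation_radius x)%E.
Proof.
move=> a0 c0; rewrite /mesh_ratio.
case: (separation_radius x) sep_fin separation_radius_ge0 => [s| |]// _.
case: (covering_radius x) cov_fin cov_gt0 => [h| |]// _.
rewrite lte_fin lee_fin => h0 s0; rewrite eqe.
have [->|sn0] := eqVneq s 0.
  rewrite invey !mule0 abse0 -!EFinM !lte_fin.
  by rewrite !ltNge c0 mulr_ge0// ltW.
have {sn0} s0' : 0 < s by rewrite lt_neqAle eq_sym sn0.
rewrite inver gt_eqF// -!EFinM inver gt_eqF ?divr_gt0// -EFinM abse_EFin.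
rewrite !lte_fin ger0_norm ?invfM ?invrK.
  by rewrite [h^-1 * s]mulrC mulrA ltr_pdivlMr.
by rewrite mulr_ge0// mulr_ge0// invr_ge0 ltW.
Qed.

End SeparationRadius.

(** * Lebesgue measure of cubes *)

Section LebesgueBox.
Context {R : realType}.

Lemma lebesgue_tuple_set0 d : lebesgue_tuple (set0 : set (d.-tuple R)) = 0%E.
Proof.
elim: d => [|d IH] /=; first by rewrite diracE in_set0.
rewrite /pushforward preimage_set0 /product_measure1/=.
by under eq_integral do rewrite xsection0 IH; rewrite integral0.
Qed.

Definition half_open_box d (lo : 'I_d -> R) (s : R) : set (d.-tuple R) :=
  [set x | forall j, lo j <= tnth x j < lo j + s].

Lemma measurable_half_open_box d (lo : 'I_d -> R) s :
  measurable (half_open_box lo s).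
Proof.
rewrite (_ : half_open_box lo s = \bigcap_(j in [set: 'I_d])
    ((fun x => tnth x j) @^-1` [set` `[lo j, lo j + s[])).
  apply: fin_bigcap_measurable => // j _.
  rewrite -[X in measurable X]setTI.
  by apply: measurable_tnth => //; exact: measurable_itv.
apply/seteqP; split=> x hx j; first by move=> _; have := hx j; rewrite /= in_itv.
by have := hx j I; rewrite /= in_itv.
Qed.

Lemma lebesgue_half_open_box d (lo : 'I_d -> R) s : 0 < s ->
  lebesgue_tuple (half_open_box lo s) = (s ^+ d)%:E.
Proof.
move=> s0; elim: d lo => [|d IH] lo /=.
  by rewrite diracE mem_set// => -[].
rewrite /pushforward /product_measure1/=.
pose D : set R := `[lo ord0, lo ord0 + s[%classic.
have mD : measurable D by exact: measurable_itv.
(* The slice of the cube over [x] is a cube of one dimension less if [x] lies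
   in the first edge [D], and empty otherwise. *)
pose lo' j := lo (lift ord0 j).
rewrite (_ : (fun x => _) = (fun x => ((s ^+ d)%:E * (\1_D x)%:E)%E)); last first.
  apply/funext => x; rewrite indicE.
  case: (pselect (D x)) => Dx.
    rewrite mem_set// mule1 -(IH lo'); congr (lebesgue_tuple _).
    rewrite /xsection; apply/seteqP; split=> y.
      by rewrite /= inE /= => hy j; have := hy (lift ord0 j); rewrite tnthS.
    rewrite /= inE /= => hy j; case: (unliftP ord0 j) => [k|] ->.
      by rewrite tnthS; exact: hy.
    by move: Dx; rewrite /D/= in_itv.
  rewrite memNset// mule0 -[RHS](lebesgue_tuple_set0 d); congr (lebesgue_tuple _).
  apply/seteqP; split=> // y; rewrite /xsection/= inE /= => /(_ ord0) hy.
  by apply: Dx; rewrite /D/= in_itv.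
rewrite ge0_integralZl//=; last by rewrite lee_fin exprn_ge0// ltW.
  rewrite integral_indic// setIT/= lebesgue_measure_itv/= lte_fin ltrDl s0.
  by rewrite -EFinB addrAC subrr add0r -EFinM exprSr.
by apply/measurable_EFinP; exact: measurable_indic.
Qed.

End LebesgueBox.

(** * Union bound and independence *)

Section Independence.
Context {R : realType} {disp : measure_display} {T : measurableType disp}.
Variable P : probability T R.

Lemma union_bound (K : finType) (D : {pred K}) (A : K -> set T) (B : set T) :
  (forall k, k \in D -> measurable (A k)) -> measurable B ->
  (forall w, B w -> exists2 k, k \in D & A k w) ->
  (P B <= \sum_(k in D) P (A k))%E.
Proof.
move=> mA mB BA; rewrite -big_enum fsbig_seq ?enum_uniq//.
apply: content_sub_fsum => //= [k|w /BA[k kD Akw]].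
  by rewrite mem_enum; exact: mA.
by exists k => //=; rewrite mem_enum.
Qed.

Context {disp' : measure_display} {T' : measurableType disp'} {I : finType}.
Variable X : I -> {RV P >-> T'}.
Hypothesis indep : mutually_independent X.

Lemma measurable_RV_preimage i (A : set T') :
  measurable A -> measurable (X i @^-1` A).
Proof.
by move=> mA; rewrite -[X in measurable X]setTI; exact: measurable_funP.
Qed.

(** Independence along any injective family of indices, so that an index may be
    treated according to the role it plays rather than to its value. *)
Lemma independent_injective (K : finType) (e : K -> I) (A : K -> set T') :
  injective e -> (forall k, measurable (A k)) ->
  P [set w | forall k, A k (X (e k) w)] = (\prod_k P (X (e k) @^-1` A k))%E.
Proof.
move=> e_inj mA.
pose A' i := if [pick k | e k == i] is Some k then A k else setT.
have A'e k : A' (e k) = A k.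
  rewrite /A'; case: pickP => [k' /eqP/e_inj ->//|/(_ k)].
  by rewrite eqxx.
have mA' i : measurable (A' i) by rewrite /A'; case: pickP.
have := indep (e @: K)%SET mA'.
rewrite big_imset /=; last by move=> ? ? _ _; exact: e_inj.
under [X in _ = X]eq_bigr do rewrite A'e.
move=> <-; congr (P _); apply/seteqP; split=> w /=.
  by move=> Aw _ /imsetP[k _ ->]; rewrite A'e; exact: Aw.
move=> Aw k; have := Aw (e k); rewrite /= A'e; apply.
by apply/imsetP; exists k.
Qed.

(** Disjoint pairs of variables behave as independent pairs.  Choosing one
    [v] for every [k] gives an event that constrains each variable separately,
    and the union bound over all choices expands the product on the right.  When
    the sets [B k v] partition the space, the sum over [v] averages the
    conditional probability [c k v] over the value of [X (r k)]. *)
Lemma independent_pairs (K V : finType) (l r : K -> I)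
    (B C : K -> V -> set T') (b c : K -> V -> R) (E : set T) :
  injective (fun s : K + K => match s with inl k => l k | inr k => r k end) ->
  (forall k v, measurable (B k v)) -> (forall k v, measurable (C k v)) ->
  (forall k v, P (X (r k) @^-1` B k v) = (b k v)%:E) ->
  (forall k v, P (X (l k) @^-1` C k v) = (c k v)%:E) ->
  measurable E ->
  (forall w, E w -> forall k, exists v,
     B k v (X (r k) w) /\ C k v (X (l k) w)) ->
  (P E <= (\prod_k \sum_v b k v * c k v)%:E)%E.
Proof.
move=> lr_inj mB mC PB PC mE EBC.
pose e (s : K + K) := match s with inl k => l k | inr k => r k end.
pose A (g : {ffun K -> V}) s :=
  match s with inl k => C k (g k) | inr k => B k (g k) end.
have mA g s : measurable (A g s) by case: s => k; [exact: mC|exact: mB].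
have PA g : P [set w | forall s, A g s (X (e s) w)] =
    (\prod_k (b k (g k) * c k (g k)))%:E.
  rewrite independent_injective// big_sumType/=.
  under eq_bigr do rewrite PC.
  under [X in (_ * X)%E]eq_bigr do rewrite PB.
  by rewrite !prodEFin -EFinM -big_split/=; congr EFin;
    apply: eq_bigr => k _; rewrite mulrC.
apply: (@le_trans _ _ (\sum_(g in {ffun K -> V})
    P [set w | forall s, A g s (X (e s) w)])%E).
  apply: union_bound => // [g _|w Ew].
    rewrite (_ : mkset _ = \bigcap_(s in [set: K + K]%type) (X (e s) @^-1` A g s)).
      apply: fin_bigcap_measurable => // s _; exact: measurable_RV_preimage.
    by apply/seteqP; split=> w h s => [_|]; [exact: h|exact: (h s Logic.I)].
  have /choice[g gP] := EBC w Ew; exists [ffun k => g k] => //= -[k|k] /=;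
  by rewrite ffunE; case: (gP k).
by rewrite (eq_bigr _ (fun g _ => PA g)) sumEFin bigA_distr_bigA.
Qed.

End Independence.

(** * Fine cells *)

Section FineCell.
Context {R : realType} {d : nat}.

(** The coordinates [a] are counted in units of [1 / (n * m)], so that the cell
    lies in the grid cube with coordinates [a %/ m]. *)
Definition fine_cell (n m : nat) (a : 'I_d -> nat) : set (d.-tuple R) :=
  half_open_box (fun j => (a j)%:R / (n * m)%:R) (n * m)%:R^-1.

Lemma grid_cube_half_open_box n (i : d.-tuple 'I_n) :
  grid_cube i = half_open_box (fun j => (tnth i j)%:R / n%:R : R) n%:R^-1.
Proof.
apply/seteqP; split=> x h j; have := h j.
  by rewrite -natr1 mulrDl mul1r.
by rewrite -[in X in _ -> X]natr1 mulrDl mul1r.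
Qed.

Context {n m : nat}.
Hypotheses (n_gt0 : (0 < n)%N) (m_gt0 : (0 < m)%N).

Lemma fine_cell_grid_cube (i : d.-tuple 'I_n) (a : 'I_d -> nat) :
  (forall j, a j %/ m = tnth i j)%N -> fine_cell n m a `<=` grid_cube i.
Proof.
move=> ai x xa j; have := xa j.
have nm0 : 0 < (n * m)%:R :> R by rewrite ltr0n muln_gt0 n_gt0.
have n0 : 0 < n%:R :> R by rewrite ltr0n.
have m0 : 0 < m%:R :> R by rewrite ltr0n.
have im : (tnth i j * m <= a j < (tnth i j).+1 * m)%N.
  by rewrite -ai leq_trunc_div ltn_ceil.
have E k : k%:R / n%:R = (k * m)%:R / (n * m)%:R :> R.
  by rewrite !natrM -mulf_div divff ?gt_eqF// mulr1.
rewrite !E -[X in _ + X]mul1r -mulrDl natr1 => /andP[xa1 xa2]; apply/andP; split.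
  apply: le_trans xa1; rewrite ler_pM2r ?invr_gt0// ler_nat; by case/andP: im.
apply: lt_le_trans xa2 _; rewrite ler_pM2r ?invr_gt0// ler_nat; by case/andP: im.
Qed.

Definition fine_index (x : d.-tuple R) (j : 'I_d) : nat :=
  Num.truncn (tnth x j * (n * m)%:R).

Lemma fine_index_div (i : d.-tuple 'I_n) (x : d.-tuple R) j :
  grid_cube i x -> (fine_index x j %/ m = tnth i j)%N.
Proof.
move=> /(_ j) /andP[x1 x2].
have n0 : 0 < n%:R :> R by rewrite ltr0n.
have m0 : 0 < m%:R :> R by rewrite ltr0n.
move: x1 x2; rewrite ler_pdivrMr// ltr_pdivlMr// => x1 x2.
have x0 : 0 <= tnth x j * (n * m)%:R.
  by rewrite natrM mulrA mulr_ge0//; apply: le_trans x1.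
apply/eqP; rewrite eqn_leq leq_divRL// -ltnS ltn_divLR//.
rewrite /fine_index truncn_lt_nat// truncn_ge_nat// !natrM !mulrA.
by rewrite ltr_pM2r// ler_pM2r// x1 x2.
Qed.

Lemma fine_cell_index (i : d.-tuple 'I_n) (x : d.-tuple R) :
  grid_cube i x -> fine_cell n m (fine_index x) x.
Proof.
move=> xi j; have nm0 : 0 < (n * m)%:R :> R by rewrite ltr0n muln_gt0 n_gt0.
have x0 : 0 <= tnth x j * (n * m)%:R.
  by rewrite mulr_ge0//; have /andP[+ _] := xi j; apply: le_trans.
have /andP[] := truncn_itv x0; rewrite -/(fine_index x j) => h1 h2.
by rewrite ler_pdivrMr// h1 -[X in _ + X]mul1r -mulrDl natr1 ltr_pdivlMr.
Qed.

Lemma fine_index_close (x y : d.-tuple R) j :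
  0 <= tnth x j -> 0 <= tnth y j ->
  dist_sup x y < (n * m)%:R^-1 -> (fine_index x j <= (fine_index y j).+1)%N.
Proof.
move=> x0 y0 xy; have nm0 : 0 < (n * m)%:R :> R by rewrite ltr0n muln_gt0 n_gt0.
have := le_lt_trans (coord_le_dist_sup x y j) xy.
rewrite ltr_norml => /andP[_]; rewrite ltrBlDl -[X in _ + X]mul1r.
rewrite -(ltr_pM2r nm0) mulrDl divfK ?gt_eqF// => xy'.
rewrite -ltnS /fine_index truncn_lt_nat ?mulr_ge0//.
apply: lt_trans xy' _; rewrite -[X in _ < X]natr1 ltrD2r.
by rewrite truncnS_gt.
Qed.

Context {disp : measure_display} {T : measurableType disp}.
Variables (P : probability T R) (X : d.-tuple 'I_n -> {RV P >-> d.-tuple R}).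
Hypothesis jit : jittered_sample X.

Lemma prob_fine_cell (i : d.-tuple 'I_n) (a : 'I_d -> nat) :
  (forall j, a j %/ m = tnth i j)%N ->
  P (X i @^-1` fine_cell n m a) = ((m%:R ^+ d)^-1)%:E.
Proof.
move=> ai; have [_ _ unif] := jit.
rewrite [LHS](unif i (fine_cell n m a)); last exact: measurable_half_open_box.
rewrite setIidl; last exact: fine_cell_grid_cube.
rewrite grid_cube_half_open_box
  !lebesgue_half_open_box ?invr_gt0 ?ltr0n ?muln_gt0 ?n_gt0//.
have n0 : n%:R != 0 :> R by rewrite pnatr_eq0 -lt0n.
rewrite inver expf_eq0 invr_eq0 (negPf n0) andbF -EFinM natrM
  !exprVn exprMn invfM invrK.
by rewrite mulrAC mulVf ?mul1r// expf_neq0.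
Qed.

End FineCell.
Arguments fine_index {R d} n m x j.

(** * Counting adjacent indices *)

Section AdjacentIndices.

Definition adjacent (N : nat) : {set 'I_N * 'I_N} :=
  [set p : 'I_N * 'I_N | (p.1 <= p.2.+1)%N && (p.2 <= p.1.+1)%N]%SET.

Definition crossing (n m : nat) : {set 'I_(n * m) * 'I_(n * m)} :=
  [set p in adjacent (n * m) | (p.1 %/ m != p.2 %/ m)%N]%SET.

Lemma card_adjacent N : (#|adjacent N| <= 3 * N)%N.
Proof.
pose f (p : 'I_N * 'I_N) := (inord (p.2.+1 - p.1) : 'I_3, p.1).
have f_inj : {in adjacent N &, injective f}.
  move=> [a b] [a' b']; rewrite !inE /= => /andP[h1 h2] /andP[h3 h4].
  move=> /(congr1 (fun q : 'I_3 * 'I_N => (val q.1, val q.2))) /=.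
  rewrite !inordK; try lia.
  by move=> [h5 h6]; congr pair; apply/val_inj => /=; lia.
rewrite -(card_in_imset f_inj); apply: leq_trans (max_card _) _.
by rewrite card_prod !card_ord.
Qed.

Lemma divn_succ_neq a m : (0 < m)%N -> (a %/ m != a.+1 %/ m)%N ->
  a.+1 = (a.+1 %/ m * m)%N.
Proof.
move=> m0 ne; apply/esym/divnK; apply: contraNT ne => /negPf.
by rewrite divnS// => ->; rewrite add0n.
Qed.

(** Two adjacent indices lying in different blocks surround a multiple of [m],
    so that they are determined by that multiple and by their order. *)
Lemma card_crossing n m : (0 < m)%N -> (#|crossing n m| <= 2 * n)%N.
Proof.
case: n => [|n] m0.
  rewrite (_ : crossing 0 m = finset.set0) ?cards0//.
  by apply/setP => -[[a a0] b]; exfalso; move: a0; rewrite mul0n.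
pose f (p : 'I_(n.+1 * m) * 'I_(n.+1 * m)) :=
  ((p.1 < p.2)%N, inord (maxn p.1 p.2 %/ m) : 'I_n.+1).
have f_inj : {in crossing n.+1 m &, injective f}.
  move=> [a b] [a' b']; rewrite !inE /=.
  move=> /andP[/andP[h1 h2] ne] /andP[/andP[h3 h4] ne'].
  move=> /(congr1 (fun q : bool * 'I_n.+1 => (q.1, val q.2))) /=.
  have bnd (i j : 'I_(n.+1 * m)) : (maxn i j %/ m < n.+1)%N.
    by rewrite ltn_divLR// gtn_max !ltn_ord.
  rewrite !inordK// => -[lt_ab].
  have ab : nat_of_ord a != b by apply: contraNneq ne => ->.
  have ab' : nat_of_ord a' != b' by apply: contraNneq ne' => ->.
  have [ltab|leba] := ltnP a b.
    have [Eb Eb'] : (b = a.+1 :> nat /\ b' = a'.+1 :> nat)%N by lia.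
    rewrite (maxn_idPr _) 1?(maxn_idPr _); try lia.
    move: ne ne'; rewrite Eb Eb' => /(divn_succ_neq m0) e /(divn_succ_neq m0) e'.
    by move=> E0; rewrite -E0 -e in e'; congr pair; apply/val_inj => /=; lia.
  have [Ea Ea'] : (a = b.+1 :> nat /\ a' = b'.+1 :> nat)%N by lia.
  rewrite (maxn_idPl _) 1?(maxn_idPl _); try lia.
  move: ne ne'; rewrite Ea Ea' eq_sym => /(divn_succ_neq m0) e.
  rewrite eq_sym => /(divn_succ_neq m0) e'.
  by move=> E0; rewrite -E0 -e in e'; congr pair; apply/val_inj => /=; lia.
rewrite -(card_in_imset f_inj); apply: leq_trans (max_card _) _.
by rewrite card_prod card_bool card_ord.
Qed.

End AdjacentIndices.

(** * No pair of points is too close *)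

Section ClosePairs.
Context {R : realType} {d n m : nat} {disp : measure_display}
  {T : measurableType disp}.
Variables (P : probability T R) (X : d.-tuple 'I_n -> {RV P >-> d.-tuple R}).
Hypotheses (n_gt0 : (0 < n)%N) (m_gt0 : (0 < m)%N) (jit : jittered_sample X).

Lemma coarse_subproof (a : 'I_(n * m)) : (a %/ m < n)%N.
Proof. by rewrite ltn_divLR. Qed.

Definition coarse (f : 'I_d -> 'I_(n * m)) : d.-tuple 'I_n :=
  [tuple Ordinal (coarse_subproof (f j)) | j < d].

Lemma coarse_div (f : 'I_d -> 'I_(n * m)) j : (f j %/ m)%N = tnth (coarse f) j.
Proof. by rewrite tnth_mktuple. Qed.

Lemma prob_two_fine_cells (f g : 'I_d -> 'I_(n * m)) : coarse f != coarse g ->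
  P (X (coarse f) @^-1` fine_cell n m f `&` X (coarse g) @^-1` fine_cell n m g)
  = ((m%:R ^+ d)^-1 ^+ 2)%:E.
Proof.
move=> fg; have [_ indep _] := jit.
pose h (b : bool) := if b then f else g.
have h_inj : injective (fun b => coarse (h b)).
  by case=> [] []//= /eqP; rewrite ?(negPf fg) // eq_sym (negPf fg).
have := independent_injective indep h_inj
  (fun b => measurable_half_open_box (fun j => (h b j)%:R / (n * m)%:R) _).
move=> /(_ (n * m)%:R^-1); rewrite big_bool /=.
rewrite !(prob_fine_cell n_gt0 m_gt0 jit) => [|j|j]; try exact: coarse_div.
rewrite -EFinM -expr2 => <-; congr (P _); apply/seteqP; split=> w /=.
  by move=> [? ?] [].
by move=> hw; split; [exact: (hw true)|exact: (hw false)].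
Qed.

(** Two close points lie in adjacent fine cells, and since their grid cubes
    differ in some coordinate [j], the fine indices cross a grid plane there.
    The bound counts the choices of [j], of a crossing pair in coordinate [j]
    and of an adjacent pair in each of the others. *)
Lemma prob_close_pair (B : set T) : measurable B ->
  (forall w, B w -> exists i i',
     i != i' /\ dist_sup (X i w) (X i' w) < (n * m)%:R^-1) ->
  (P B <= ((d * (2 * n * (3 * (n * m)) ^ d.-1))%N%:R
            * (m%:R ^+ d)^-1 ^+ 2)%:E)%E.
Proof.
move=> mB close; have [cubeX _ _] := jit.
pose Q := ('I_(n * m) * 'I_(n * m))%type.
pose F (j l : 'I_d) : {set Q} := if l == j then crossing n m else adjacent (n * m).
pose D := [pred q : 'I_d * {ffun 'I_d -> Q} | q.2 \in family (F q.1)].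
pose f1 (q : 'I_d * {ffun 'I_d -> Q}) j := (q.2 j).1.
pose f2 (q : 'I_d * {ffun 'I_d -> Q}) j := (q.2 j).2.
pose A q := X (coarse (f1 q)) @^-1` fine_cell n m (f1 q)
  `&` X (coarse (f2 q)) @^-1` fine_cell n m (f2 q).
have mA q : measurable (A q).
  by apply: measurableI; apply: measurable_RV_preimage;
    exact: measurable_half_open_box.
have PA q : q \in D -> P (A q) = ((m%:R ^+ d)^-1 ^+ 2)%:E.
  move=> /familyP qD; apply: prob_two_fine_cells.
  have := qD q.1; rewrite /F eqxx !inE => /andP[_].
  apply: contraNneq => /(congr1 (fun t => val (tnth t q.1))).
  by rewrite !tnth_mktuple /= => ->.
apply: (@le_trans _ _ (\sum_(q in D) P (A q))%E).
  apply: union_bound => //.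
  move=> w /close[i [i' [ii' dw]]].
  have [j ij] : exists j, tnth i j != tnth i' j.
    apply/existsP; apply: contraNT ii' => /existsPn h; apply/eqP/eq_from_tnth => j.
    by apply/eqP; have := h j; rewrite negbK.
  have lt_nm k (j' : 'I_d) : (fine_index n m (X k w) j' < n * m)%N.
    by rewrite -ltn_divLR// (fine_index_div n_gt0 m_gt0 _ (cubeX k w)).
  pose q : 'I_d * {ffun 'I_d -> Q} :=
    (j, [ffun j' => (Ordinal (lt_nm i j'), Ordinal (lt_nm i' j'))]).
  have E1 : f1 q = fun j' => Ordinal (lt_nm i j').
    by apply/funext => j'; rewrite /f1 ffunE.
  have E2 : f2 q = fun j' => Ordinal (lt_nm i' j').
    by apply/funext => j'; rewrite /f2 ffunE.
  have C1 : coarse (f1 q) = i.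
    apply: eq_from_tnth => j'; apply/val_inj; rewrite tnth_mktuple E1 /=.
    exact: fine_index_div.
  have C2 : coarse (f2 q) = i'.
    apply: eq_from_tnth => j'; apply/val_inj; rewrite tnth_mktuple E2 /=.
    exact: fine_index_div.
  have x0 k (j' : 'I_d) : 0 <= tnth (X k w) j'.
    by have /andP[+ _] := cubeX k w j'; apply: le_trans; rewrite divr_ge0.
  exists q.
    apply/familyP => l; rewrite /F ffunE.
    have adj : (Ordinal (lt_nm i l), Ordinal (lt_nm i' l)) \in adjacent (n * m).
      rewrite !inE /=; apply/andP; split; first exact: fine_index_close.
      apply: fine_index_close => //.
      apply: le_lt_trans dw; apply: dist_sup_le => [|j'].
        exact: dist_sup_ge0.
      by rewrite distrC coord_le_dist_sup.
    case: eqP => [lj|//]; rewrite lj in adj *; rewrite inE; apply/andP; split=> //=.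
    rewrite (fine_index_div n_gt0 m_gt0 _ (cubeX i w)).
    by rewrite (fine_index_div n_gt0 m_gt0 _ (cubeX i' w)).
  by split=> /=; rewrite ?C1 ?C2 ?E1 ?E2; apply: fine_cell_index.
rewrite (eq_bigr _ PA) sumEFin lee_fin sumr_const -[leLHS]mulr_natl.
apply: ler_wpM2r; first by rewrite exprn_ge0// invr_ge0 exprn_ge0.
rewrite ler_nat -sum1_card
  (eq_bigl (fun q => (q.1 \in 'I_d) && (q.2 \in family (F q.1)))) //.
rewrite -(pair_big_dep _ (fun j f => f \in family (F j)) (fun _ _ => 1%N))/=.
rewrite -[X in (_ <= X * _)%N](card_ord d) -sum_nat_const.
apply: leq_sum => j _; rewrite sum1_card card_family foldrE big_image/=.
rewrite (bigD1 j)//= /F eqxx; apply: leq_mul; first exact: card_crossing.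
apply: (@leq_trans (\prod_(l < d | l != j) (3 * (n * m)))).
  by apply: leq_prod => l /negPf ->; exact: card_adjacent.
rewrite prod_nat_const leq_eqVlt; apply/orP; left; apply/eqP; congr (_ ^ _)%N.
by rewrite (cardC1 j) card_ord.
Qed.

End ClosePairs.

(** * Some pair of points is close *)

Section NoClosePair.
Context {R : realType} {d n m : nat} {disp : measure_display}
  {T : measurableType disp}.
Variables (P : probability T R)
  (X : d.+1.-tuple 'I_n -> {RV P >-> d.+1.-tuple R}).
Hypotheses (n_gt0 : (0 < n)%N) (m_gt0 : (0 < m)%N) (jit : jittered_sample X).

Lemma double_lt (k : 'I_n./2) : (k.*2 < n)%N.
Proof. by have := ltn_ord k; lia. Qed.

Lemma doubleS_lt (k : 'I_n./2) : (k.*2.+1 < n)%N.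
Proof. by have := ltn_ord k; lia. Qed.

(** The cubes with first coordinates [2k] and [2k+1] share a face, and these
    pairs of cubes are disjoint.  For odd [n] the last layer stays unpaired. *)
Definition left_cube (k : 'I_n./2 * d.-tuple 'I_n) : d.+1.-tuple 'I_n :=
  [tuple of Ordinal (double_lt k.1) :: k.2].

Definition right_cube (k : 'I_n./2 * d.-tuple 'I_n) : d.+1.-tuple 'I_n :=
  [tuple of Ordinal (doubleS_lt k.1) :: k.2].

Definition subcell (i : d.+1.-tuple 'I_n) (u : 'I_m) (t : d.-tuple 'I_m)
    (j : 'I_d.+1) : nat :=
  (tnth i j * m + tnth [tuple of u :: t] j)%N.

Lemma subcell_div i u t j : (subcell i u t j %/ m)%N = tnth i j.
Proof. by rewrite /subcell divnMDl// divn_small ?addn0// ltn_ord. Qed.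

Lemma left_right_inj : injective (fun s =>
  match s with inl k => left_cube k | inr k => right_cube k end).
Proof.
have tupE (a b : 'I_n) (s t : d.-tuple 'I_n) :
    [tuple of a :: s] = [tuple of b :: t] -> a = b :> nat /\ s = t.
  by move=> /(congr1 val)[-> st]; split=> //; apply: val_inj.
by case=> [[k s]|[k s]] [[k' s']|[k' s']] /tupE[/= kk' ->];
  try lia; rewrite (_ : k = k')//; apply: val_inj => /=; lia.
Qed.

(** The two cells touch across the face common to the paired cubes: they are
    the last cell on the left and the first one on the right, in the same
    position [t] along the face. *)
Lemma subcells_close k (u0 u1 : 'I_m) t (x y : d.+1.-tuple R) :
  u0 = 0%N :> nat -> u1 = m.-1 :> nat ->
  fine_cell n m (subcell (left_cube k) u1 t) x ->
  fine_cell n m (subcell (right_cube k) u0 t) y ->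
  dist_sup x y <= 2 / (n * m)%:R.
Proof.
move=> u00 u1m hx hy; have v0 : 0 <= (n * m)%:R^-1 :> R by rewrite invr_ge0.
apply: dist_sup_le => [|j]; first by rewrite mulr_ge0.
have /andP[x1 x2] := hx j; have /andP[y1 y2] := hy j.
move: x1 x2 y1 y2; rewrite /subcell /left_cube /right_cube.
case: (unliftP ord0 j) => [j'|] ->; rewrite ?tnthS ?tnth0 => x1 x2 y1 y2.
  by rewrite ler_distl; apply/andP; split; lra.
move: x1 x2 y1 y2; rewrite /= u00 u1m addn0.
have -> : ((k.1.*2.+1 * m) = (k.1.*2 * m + m.-1).+1)%N by lia.
rewrite -[X in _ -> _ -> X / _ <= _ -> _]natr1
  -[X in _ -> _ -> _ -> _ < X / _ + _ -> _]natr1.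
rewrite !mulrDl mul1r => x1 x2 y1 y2.
by rewrite ler_distl; apply/andP; split; lra.
Qed.

(** Given the right point of a pair, the left one must avoid one single cell if
    the right one lies in a cell at the common face, and is unconstrained
    otherwise.  A right point is at the face with probability [1 / m], and the
    left one then hits the cell with probability [1 / m ^ (d + 1)]. *)
Lemma prob_no_close_pair (E : set T) : measurable E ->
  (forall w, E w -> forall i i', i != i' ->
     2 / (n * m)%:R < dist_sup (X i w) (X i' w)) ->
  (P E <= ((1 - (m%:R ^+ d.+2)^-1) ^+ (n./2 * n ^ d))%:E)%E.
Proof.
move=> mE far; have [cubeX indep _] := jit.
pose q : R := (m%:R ^+ d.+1)^-1.
have m1_lt : (m.-1 < m)%N by rewrite prednK.
pose last_cell k t : set (d.+1.-tuple R) :=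
  fine_cell n m (subcell (left_cube k) (Ordinal m1_lt) t).
pose B k (v : 'I_m * d.-tuple 'I_m) : set (d.+1.-tuple R) :=
  fine_cell n m (subcell (right_cube k) v.1 v.2).
pose C k (v : 'I_m * d.-tuple 'I_m) : set (d.+1.-tuple R) :=
  if v.1 == 0%N :> nat then ~` last_cell k v.2 else setT.
have mcell a : measurable (fine_cell n m a : set (d.+1.-tuple R)).
  exact: measurable_half_open_box.
have mC k v : measurable (C k v).
  rewrite /C; case: ifP => _; last exact: measurableT.
  by apply: measurableC; exact: mcell.
apply: le_trans (independent_pairs indep left_right_inj (B := B) (C := C)
  (b := fun _ _ => q)
  (c := fun _ v => 1 - (if v.1 == 0%N :> nat then q else 0)) _ mC _ _ mE _) _.
- by move=> k v; exact: mcell.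
- move=> k v; rewrite /B (prob_fine_cell n_gt0 m_gt0 jit) // => j.
  exact: subcell_div.
- move=> k v; rewrite /C; case: ifP => _.
    rewrite -preimage_setC probability_setC; last first.
      by apply: measurable_RV_preimage; exact: mcell.
    rewrite EFinB (prob_fine_cell n_gt0 m_gt0 jit)//.
    by move=> j; exact: subcell_div.
  by rewrite preimage_setT probability_setT subr0.
- move=> w Ew k.
  (* [v] is the cell of the right point, by its position in its own cube. *)
  pose a := fine_index n m (X (right_cube k) w).
  have a_mod j : (a j %% m < m)%N by rewrite ltn_mod.
  pose v : 'I_m * d.-tuple 'I_m :=
    (Ordinal (a_mod ord0), [tuple Ordinal (a_mod (lift ord0 j)) | j < d]).
  have Bv : B k v (X (right_cube k) w).
    rewrite /B (_ : subcell _ _ _ = a); last first.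
      apply/funext => j; rewrite [RHS](divn_eq _ m).
      rewrite (fine_index_div n_gt0 m_gt0 _ (cubeX (right_cube k) w)).
      rewrite /subcell; congr addn; case: (unliftP ord0 j) => [j'|] ->.
        by rewrite tnthS tnth_mktuple.
      by rewrite tnth0.
    exact: fine_cell_index.
  exists v; split => //; rewrite /C; case: eqP => // v0 Lv.
  have := subcells_close v0 (erefl : Ordinal m1_lt = m.-1 :> nat) Lv Bv.
  rewrite leNgt far//; apply/eqP => lr.
  by have := @left_right_inj (inl k) (inr k) lr.
rewrite lee_fin prodr_const card_prod card_tuple !card_ord.
rewrite -mulr_sumr -(pair_big xpredT xpredT (fun (u : 'I_m)
  (t : d.-tuple 'I_m) => 1 - (if u == 0%N :> nat then q else 0)))/=.
have m0 : m%:R != 0 :> R by rewrite pnatr_eq0 -lt0n.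
under eq_bigr do rewrite sumr_const card_tuple card_ord.
rewrite sumrMnl sumrB sumr_const card_ord -big_mkcond/=.
rewrite (big_pred1 (Ordinal m_gt0)) => [|u] /=; last by rewrite -val_eqE.
rewrite -[_ *+ (m ^ d)%N]mulr_natr natrX.
suff -> : q * ((m%:R - q) * m%:R ^+ d) = 1 - (m%:R ^+ d.+2)^-1 by [].
rewrite /q !exprS; field; by rewrite expf_neq0// m0.
Qed.

End NoClosePair.

(** * Numerical bounds *)

Section NumericalBounds.
Context {R : realType}.

(** Dual to Bernoulli's inequality: [M] independent trials of success
    probability [p] all fail with probability at most [1 / (1 + M p)]. *)
Lemma exprn_subr1_le (p : R) (M : nat) : 0 <= p <= 1 ->
  (1 - p) ^+ M * (1 + M%:R * p) <= 1.
Proof.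
move=> /andP[p0 p1]; elim: M => [|M IH]; first by rewrite expr0 mul0r addr0 mulr1.
apply: le_trans IH; rewrite exprSr -mulrA; apply: ler_wpM2l.
  by rewrite exprn_ge0// subr_ge0.
rewrite -natr1; have : 0 <= (M%:R + 1) * p * p by rewrite !mulr_ge0// addr_ge0.
by move=> ?; lra.
Qed.

Lemma exprn_root (x : R) k : 0 <= x -> (x `^ k.+1%:R^-1) ^+ k.+1 = x.
Proof.
by move=> x0; rewrite -powR_mulrn ?powR_ge0// -powRrM mulVf ?pnatr_eq0// powRr1.
Qed.

Lemma natr_exp_powRN_inv n d : (0 < d)%N ->
  (n ^ d)%N%:R `^ (- d%:R^-1) = n%:R^-1 :> R.
Proof.
move=> d0; rewrite natrX -powR_mulrn// -powRrM mulrN mulfV ?pnatr_eq0 -?lt0n//.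
by rewrite powR_inv1.
Qed.

Lemma nat_between (y : R) : 1 <= y ->
  exists2 m : nat, (0 < m)%N & y <= m%:R <= 2 * y.
Proof.
move=> y1; have y0 : 0 <= y by lra.
exists (Num.truncn y).+1 => //; have /andP[t1 t2] := truncn_itv y0.
by rewrite ltW//= -natr1; lra.
Qed.

Lemma close_pair_bound d n m (L : R) (a : R) : (0 < n)%N -> 1 <= L -> 1 <= a ->
  a ^+ d.+2 = (n ^ d.+1)%N%:R -> L * a <= m%:R ->
  (d.+1 * (2 * n * (3 * (n * m)) ^ d))%N%:R * (m%:R ^+ d.+1)^-1 ^+ 2
    <= (d.+1 * 2 * 3 ^ d)%N%:R / L.
Proof.
move=> n0 L1 a1 aE Lam.
have m0 : 0 < m%:R :> R by apply: lt_le_trans Lam; apply: mulr_gt0; lra.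
rewrite (_ : _ * _ = (d.+1 * 2 * 3 ^ d)%N%:R * (a / m%:R) ^+ d.+2); last first.
  rewrite expr_div_n aE !(natrM, natrX) !exprMn !exprS; field.
  by rewrite expf_neq0 ?gt_eqF.
apply: ler_wpM2l => //; apply: (@le_trans _ _ (L^-1 ^+ d.+2)).
  rewrite lerXn2r ?nnegrE ?divr_ge0 ?invr_ge0//; try lra.
  by rewrite ler_pdivrMr// mulrC ler_pdivlMr ?[a * L]mulrC//; lra.
rewrite exprS ger_pMr ?invr_gt0; last lra.
by rewrite exprn_ile1 ?invr_ge0 ?invf_le1; lra.
Qed.

Lemma no_close_pair_bound d n m (L : R) (a : R) : (1 < n)%N -> (0 < m)%N ->
  2 <= L -> a ^+ d.+2 = (n ^ d.+1)%N%:R -> 0 <= a -> L * m%:R <= 2 * a ->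
  (1 - (m%:R ^+ d.+2)^-1) ^+ (n./2 * n ^ d) <= 6 / L.
Proof.
move=> n1 m_gt0 L2 aE a0 Lma.
have m0 : 0 < m%:R :> R by rewrite ltr0n.
set p := (m%:R ^+ d.+2)^-1; set M := (n./2 * n ^ d)%N.
have p0 : 0 < p by rewrite invr_gt0 exprn_gt0.
have p1 : p <= 1 by rewrite invf_le1 ?exprn_gt0// exprn_ege1// ler1n.
have Mp : L / 6 <= M%:R * p.
  (* [n <= 3 * n./2] holds from [n = 2] on, with equality for [n = 3]. *)
  have nM : (n ^ d.+1)%N%:R <= 3 * M%:R :> R.
    rewrite -natrM ler_nat expnS mulnA leq_mul2r; apply/orP; right; lia.
  apply: (@le_trans _ _ ((a / m%:R) ^+ d.+2 / 3)); last first.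
    by rewrite ler_pdivrMr// expr_div_n aE -/p mulrAC ler_pM2r// mulrC.
  have h : L / 2 <= a / m%:R.
    by rewrite ler_pdivlMr// mulrAC ler_pdivrMr// [a * 2]mulrC.
  have h1 : 1 <= a / m%:R by lra.
  have : a / m%:R <= (a / m%:R) ^+ d.+2.
    by rewrite exprS ler_peMr ?exprn_ege1//; lra.
  by move=> ?; lra.
have := @exprn_subr1_le p M _; rewrite (ltW p0) p1 => /(_ isT).
rewrite -ler_pdivlMr ?mul1r => [h|]; last by lra.
apply: (le_trans h).
by rewrite -[6 / L]invrK lef_pV2 ?posrE ?invf_div; lra.
Qed.

End NumericalBounds.

(** * The mesh ratio of a jittered sample *)

Section MeshRatio.
Context {R : realType} {d n : nat} {disp : measure_display}
  {T : measurableType disp}.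
Variables (P : probability T R)
  (X : d.+1.-tuple 'I_n -> {RV P >-> d.+1.-tuple R}).
Hypotheses (n_gt1 : (1 < n)%N) (jit : jittered_sample X).

Let n_gt0 : (0 < n)%N. Proof. exact: ltnW. Qed.
Let x w i := X i w.
Let cube w i : grid_cube i (x w i). Proof. by have [cubeX _ _] := jit; exact: cubeX. Qed.

Let cov_le w : (covering_radius (x w) <= (n%:R^-1)%:E)%E.
Proof. exact: covering_radius_le. Qed.

Let cov_ge w : (((4 * n%:R)^-1)%:E <= covering_radius (x w))%E.
Proof. exact: covering_radius_ge. Qed.

Let cov_gt0 w : (0 < covering_radius (x w))%E.
Proof.
by apply: lt_le_trans (cov_ge w); rewrite lte_fin invr_gt0 mulr_gt0 ?ltr0n.
Qed.

Let cov_fin w : covering_radius (x w) \is a fin_num.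
Proof.
by rewrite ge0_fin_numE; [exact: le_lt_trans (cov_le w) (ltry _)|exact: ltW].
Qed.

Let sep_fin w : separation_radius (x w) \is a fin_num.
Proof.
pose i k : d.+1.-tuple 'I_n := [tuple k | _ < d.+1].
apply: (@separation_radius_fin _ _ _ _ (i (Ordinal n_gt0)) (i (Ordinal n_gt1))).
apply/eqP => /(congr1 (fun t => val (tnth t ord0))).
by rewrite !tnth_mktuple.
Qed.

Let measurable_lt_radii (a b : R) :
  measurable [set w | (a%:E * separation_radius (x w)
                       < b%:E * covering_radius (x w))%E].
Proof.
rewrite -[X in measurable X]setTI; apply: measurable_lte => //.
  by apply: emeasurable_funM => //; apply: measurable_separation_radius.
by apply: emeasurable_funM => //; apply: measurable_covering_radius.
Qed.

Let measurable_gt_radii (a b : R) :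
  measurable [set w | (b%:E * covering_radius (x w)
                       < a%:E * separation_radius (x w))%E].
Proof.
rewrite -[X in measurable X]setTI; apply: measurable_lte => //.
  by apply: emeasurable_funM => //; apply: measurable_covering_radius.
by apply: emeasurable_funM => //; apply: measurable_separation_radius.
Qed.

Variables (a L : R).
Hypotheses (a_ge1 : 1 <= a) (aE : a ^+ d.+2 = (n ^ d.+1)%N%:R).

(** Fine cells of side [1 / (n m)] with [m] between [L a] and [2 L a]: without a
    pair of points closer than that, the mesh ratio is at most
    [2 m <= 4 L a]. *)
Lemma prob_large_mesh_ratio : 1 <= L ->
  (P [set w | (4 * L * a)%:E < `|mesh_ratio (x w)|]
    <= ((d.+1 * 2 * 3 ^ d)%N%:R / L)%:E)%E.
Proof.
move=> L1; have La1 : 1 <= L * a by rewrite mulr_ege1.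
have L_ge0 : 0 <= L by lra.
have a_ge0 : 0 <= a := le_trans ler01 a_ge1.
have [m m_gt0 /andP[mL mU]] := nat_between La1.
have n0 : 0 < n%:R :> R by rewrite ltr0n.
have m0 : 0 < m%:R :> R by rewrite ltr0n.
rewrite (_ : mkset _ = [set w | ((4 * L * a)%:E * separation_radius (x w)
    < 1%:E * covering_radius (x w))%E]); last first.
  apply/funext => w /=; rewrite mul1e lt_mesh_ratio//.
  by rewrite !mulr_ge0.
apply: (@le_trans _ _ ((d.+1 * (2 * n * (3 * (n * m)) ^ d))%N%:R
    * (m%:R ^+ d.+1)^-1 ^+ 2)%:E); last first.
  by rewrite lee_fin; exact: close_pair_bound n_gt0 L1 a_ge1 aE mL.
apply: (prob_close_pair n_gt0 m_gt0 jit) => // w /=; rewrite mul1e.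
move=> sep_cov; apply: contrapT => far.
have sep : (((n * m)%:R^-1 / 2)%:E <= separation_radius (x w))%E.
  apply: separation_radius_ge => i i' ii'; rewrite leNgt; apply/negP => close.
  by apply: far; exists i, i'.
move: sep_cov; apply/negP; rewrite -leNgt.
apply: le_trans (cov_le w) _.
apply: (@le_trans _ _ ((4 * L * a)%:E * ((n * m)%:R^-1 / 2)%:E)%E); last first.
  by apply: lee_wpmul2l; rewrite ?lee_fin// !mulr_ge0.
rewrite -EFinM lee_fin natrM invfM -[X in X <= _]mulr1.
rewrite (_ : 4 * L * a * _ = n%:R^-1 * (2 * (L * a) / m%:R)); last first.
  by field; rewrite !gt_eqF.
by rewrite ler_pM2l ?invr_gt0// ler_pdivlMr// mul1r.
Qed.

(** Fine cells of side [1 / (n m)] with [m] between [a / L] and [2 a / L]: a pair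
    of points at distance at most [2 / (n m)] makes the mesh ratio at least
    [m / 4 >= a / (4 L)]. *)
Lemma prob_small_mesh_ratio : 2 <= L -> L <= a ->
  (P [set w | (4 * L)%:E < `|a%:E / mesh_ratio (x w)|] <= (6 / L)%:E)%E.
Proof.
move=> L2 La; have L0 : 0 < L by lra.
have aL1 : 1 <= a / L by rewrite ler_pdivlMr// mul1r.
have [m m_gt0 /andP[mL mU]] := nat_between aL1.
have n0 : 0 < n%:R :> R by rewrite ltr0n.
have m0 : 0 < m%:R :> R by rewrite ltr0n.
rewrite (_ : mkset _ = [set w | ((4 * L)%:E * covering_radius (x w)
    < a%:E * separation_radius (x w))%E]); last first.
  by apply/funext => w /=; rewrite lt_div_mesh_ratio//; lra.
apply: (@le_trans _ _ ((1 - (m%:R ^+ d.+2)^-1) ^+ (n./2 * n ^ d))%:E).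
  apply: (prob_no_close_pair n_gt0 m_gt0 jit) => // w /= cov_sep i i' ii'.
  rewrite ltNge; apply/negP => close; move: cov_sep; apply/negP; rewrite -leNgt.
  apply: (@le_trans _ _ (a%:E * (1 / (n * m)%:R)%:E)%E).
    apply: lee_wpmul2l; first by rewrite lee_fin; lra.
    apply: le_trans (separation_radius_le (x w) ii') _; rewrite lee_fin.
    by rewrite /x; lra.
  apply: le_trans (lee_wpmul2l _ (cov_ge w)); last by rewrite lee_fin; lra.
  rewrite -!EFinM lee_fin natrM.
  rewrite (_ : a * _ = n%:R^-1 * (a / m%:R)); last by field; rewrite !gt_eqF.
  rewrite (_ : 4 * L * _ = n%:R^-1 * L); last by field; rewrite !gt_eqF.
  by rewrite ler_pM2l ?invr_gt0// ler_pdivrMr// mulrC -ler_pdivrMr.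
rewrite lee_fin; apply: no_close_pair_bound aE _ _ => //; first lra.
by move: mU; rewrite mulrA ler_pdivlMr// mulrC.
Qed.

End MeshRatio.

Theorem corollary3p4 (R : realType) (d : nat) (hd : (0 < d)%N) :
  (exists c C : R, [/\ 0 < c, 0 < C &
    forall (n : nat) (disp : measure_display) (T : measurableType disp)
      (P : probability T R) (X : d.-tuple 'I_n -> {RV P >-> d.-tuple R}),
      (0 < n)%N -> jittered_sample X ->
      forall w : T,
        ((c * (n ^ d)%N%:R `^ (- d%:R^-1))%:E
           <= covering_radius (fun i => X i w)
           <= (C * (n ^ d)%N%:R `^ (- d%:R^-1))%:E)%E])
  /\
  (forall (disp : nat -> measure_display)
      (T : forall n, measurableType (disp n))
      (P : forall n, probability (T n) R)
      (X : forall n, d.-tuple 'I_n -> {RV (P n) >-> d.-tuple R}),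
      (forall n, (0 < n)%N -> jittered_sample (X n)) ->
      bigTheta_P P (fun n w => mesh_ratio (fun i => X n i w))
        (fun n => (n ^ d)%N%:R `^ (d.+1)%:R^-1)).
Proof.
split.
  exists 4^-1, 1; split=> // n disp T P X n_gt0 [cube _ _] w.
  rewrite natr_exp_powRN_inv// mul1r -invfM; apply/andP; split.
    exact: covering_radius_ge.
  exact: covering_radius_le.
case: d hd => // d _ disp T P X jit.
pose a n : R := (n ^ d.+1)%N%:R `^ d.+2%:R^-1.
have aE n : a n ^+ d.+2 = (n ^ d.+1)%N%:R by rewrite exprn_root.
have a_ge (y : R) n : 0 <= y -> y ^+ d.+2 <= n%:R -> y <= a n.
  move=> y0 yn; rewrite -(@ler_pXn2r _ d.+2) ?nnegrE ?powR_ge0// aE.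
  apply: le_trans yn _; rewrite ler_nat expnS; case: n => [//|n].
  by rewrite leq_pmulr// expn_gt0.
have a_ge1 n : (0 < n)%N -> 1 <= a n.
  by move=> n0; apply: a_ge => //; rewrite expr1n ler1n.
split=> eps eps0.
  (* [L] is chosen to make [c / L <= eps], and below [6 / L <= eps]. *)
  pose c : R := (d.+1 * 2 * 3 ^ d)%N%:R.
  have c0 : 0 <= c / eps by rewrite divr_ge0// ltW.
  exists (4 * (1 + c / eps)), 2%N; split=> [|n n2]; first lra.
  have L1 : 1 <= 1 + c / eps by lra.
  apply: le_trans
    (prob_large_mesh_ratio n2 (jit n (ltnW n2)) (a_ge1 n (ltnW n2)) (aE n) L1) _.
  rewrite lee_fin -/c ler_pdivrMr; last lra.
  by rewrite mulrDr mulr1 mulrCA divff ?gt_eqF//; lra.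
have c0 : 0 < 6 / eps by rewrite divr_gt0.
pose L := 2 + 6 / eps.
exists (4 * L), (maxn 2 (Num.truncn (L ^+ d.+2)).+1); split=> [|n].
  by rewrite /L; lra.
rewrite geq_max => /andP[n2 Ln].
have L2 : 2 <= L by rewrite /L; lra.
have La : L <= a n.
  apply: a_ge; first lra.
  by apply: le_trans (ltW (truncnS_gt _)) _; rewrite ler_nat.
rewrite mulr1; apply: le_trans
  (prob_small_mesh_ratio n2 (jit n (ltnW n2)) (aE n) L2 La) _.
rewrite lee_fin ler_pdivrMr; last lra.
by rewrite /L mulrDr mulrCA divff ?gt_eqF//; lra.
Qed.
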